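(* Let $R$ be an associative ring with unit and let $M$ and $N$ be nonsingular left $R$-modules. If $\varphi:M\to N$ is a morphism of modules, then $\varphi^{-1}\zeta_N=\zeta_M\varphi^{-1}$, that is, $\varphi^{-1}(\zeta_N(L))=\zeta_M(\varphi^{-1}(L))$ for every submodule $L\le N$, where $\zeta_N$ and $\zeta_M$ are the Goldie's nuclei on $\Lambda(N)$ and on $\Lambda(M)$ respectively.
   Context: A left module $M$ is nonsingular if $Z(M)=0$, where $Z(M)=\{m\in M\mid \{r\in R\mid rm=0\}\text{ is an essential left ideal of }R\}$. $\Lambda(M)$ is the lattice of submodules of $M$, which is an idiom, and $\varphi^{-1}:\Lambda(N)\to\Lambda(M)$ is the preimage map. An idiom is a complete lattice $A$ (least element $0$, greatest element $1$) that is modular and upper continuous (i.e. $a\wedge\bigvee X=\bigvee\{a\wedge x\mid x\in X\}$ for directed $X$). For $a\le b$, $[a,b]=\{x\mid a\le x\le b\}$ is an interval; $x\in[a,b]$ is essential in $[a,b]$ if for every $y\in[a,b]$, $x\wedge y=a$ implies $y=a$. Two intervals are similar, $I\sim J$, if $\{I,J\}=\{[l,l\vee r],[l\wedge r,r]\}$ for some $l,r\in A$; let $\approx$ be the transitive closure of $\sim$. An interval $[a,b]$ is nonsingular if whenever $a\le x\le b$ and $[c,d]\approx[a,x]$ with $c$ essential in $[0,d]$, then $c=d$. $\mathfrak{G}(A)$ is the set of nonsingular intervals of $A$. A nucleus on $A$ is a monotone map $j:A\to A$ with $a\le j(a)$, $j(a\wedge b)\ge j(a)\wedge j(b)$ and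 $j\circ j=j$; nuclei are ordered pointwise. For each interval $[a,b]$ there is a largest nucleus $\chi(a,b)$ with $\chi(a,b)(a)\wedge b=a$, and $\mathscr{F}_j=\{[a,b]\mid j\le\chi(a,b)\}$. The Goldie's nucleus on $A$ is the (unique) nucleus $\zeta$ with $\mathscr{F}_\zeta=\mathfrak{G}(A)$. *)

(* Defs.v *)
From HB Require Import structures.
From mathcomp Require Import all_boot all_order all_algebra.
From mathcomp Require Import boolp classical_sets.
From Stdlib Require Import Relations.Relation_Operators.

Set Implicit Arguments.
Unset Strict Implicit.
Unset Printing Implicit Defensive.

Import Order.Theory GRing.Theory.
Local Open Scope classical_set_scope.
Local Open Scope order_scope.

Definition directed d (A : porderType d) (X : set A) :=
  X !=set0 /\
  forall x y, X x -> X y -> exists z, [/\ X z, x <= z & y <= z].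

HB.mixin Record TBLattice_isIdiom d A of Order.TBLattice d A := {
  isup : set A -> A;
  isupP : forall X : set A, isLub X (isup X);
  idiom_modular : forall a b c : A,
    a <= c -> a `|` (b `&` c) = (a `|` b) `&` c;
  idiom_upper_continuous : forall (a : A) (X : set A), directed X ->
    a `&` isup X = isup [set a `&` x | x in X]
}.

#[short(type="idiomType")]
HB.structure Definition Idiom d :=
  { A of Order.TBLattice d A & TBLattice_isIdiom d A }.

Section Idioms.
Context d (A : idiomType d).
Implicit Types (a b c x y : A) (I J : A * A) (j k : A -> A).

Definition essential a b x :=
  a <= x <= b /\ forall y, a <= y <= b -> x `&` y = a -> y = a.

(* The interval [a, b] is represented by the pair (a, b), with a <= b. *)
Definition similar I J := exists l r,
  (I = (l, l `|` r) /\ J = (l `&` r, r)) \/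
  (J = (l, l `|` r) /\ I = (l `&` r, r)).

Definition similar_trans : A * A -> A * A -> Prop := clos_trans _ similar.

Definition nonsingular_interval a b := a <= b /\
  forall x c e, a <= x <= b -> similar_trans (c, e) (a, x) ->
    essential \bot e c -> c = e.

Definition nonsingular_intervals : set (A * A) :=
  [set I | nonsingular_interval I.1 I.2].

Definition nucleus j :=
  [/\ {homo j : x y / x <= y},
      forall x, x <= j x,
      forall x y, j x `&` j y <= j (x `&` y)
    & forall x, j (j x) = j x].

Definition nucleus_le j k := forall x, j x <= k x.

(* k is the nucleus chi(a, b). *)
Definition is_chi a b k :=
  [/\ nucleus k, k a `&` b = a
    & forall j, nucleus j -> j a `&` b = a -> nucleus_le j k].

Definition free_intervals j : set (A * A) :=
  [set I | I.1 <= I.2 /\ exists2 k, is_chi I.1 I.2 k & nucleus_le j k].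

Definition goldie_nucleus j :=
  nucleus j /\ free_intervals j = nonsingular_intervals.

End Idioms.

Section Submodules.
Context (R : pzRingType) (V : lmodType R).
Local Open Scope ring_scope.

Record submodule := Submodule {
  submodule_pred :> {pred V};
  submodule_closed : submod_closed submodule_pred
}.

HB.instance Definition _ := gen_eqMixin submodule.
HB.instance Definition _ := gen_choiceMixin submodule.

HB.instance Definition _ (L : submodule) :=
  GRing.isSubmodClosed.Build R V (submodule_pred L)
    (GRing.submod_closed_semi (submodule_closed L)).

Implicit Types K L : submodule.

Lemma submoduleN L v : v \in L -> - v \in L.
Proof. by move=> vL; rewrite -scaleN1r rpredZ. Qed.

Lemma eq_submodule K L : K =i L -> K = L.
Proof.
case: K L => [K hK] [L hL] /= eKL; have eK : K = L.
  by apply/funext => v; move: (eKL v); rewrite -!topredE.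
by subst L; rewrite (Prop_irrelevance hK hL).
Qed.

Definition submodule_le K L := `[< {subset K <= L} >].

Fact submodule_le_refl : reflexive submodule_le.
Proof. by move=> L; apply/asboolP. Qed.

Fact submodule_le_anti : antisymmetric submodule_le.
Proof.
move=> K L /andP[/asboolP sKL /asboolP sLK]; apply: eq_submodule => v.
by apply/idP/idP => [/sKL|/sLK].
Qed.

Fact submodule_le_trans : transitive submodule_le.
Proof.
move=> L K J /asboolP sKL /asboolP sLJ; apply/asboolP => v /sKL; exact: sLJ.
Qed.

Fact submodule_display : Order.disp_t. Proof. exact: Order.Disp tt tt. Qed.

HB.instance Definition _ := Order.Le_isPOrder.Build submodule_display submodule
  submodule_le_refl submodule_le_anti submodule_le_trans.

Lemma submodule_leP K L : reflect {subset K <= L} (K <= L)%O.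
Proof. exact: asboolP. Qed.

Fact submodule0_closed : submod_closed [pred v : V | v == 0].
Proof.
by split=> [|a u v /eqP-> /eqP->]; rewrite inE // scaler0 addr0.
Qed.
Definition submodule0 := Submodule submodule0_closed.

Fact submoduleT_closed : submod_closed [pred _ : V | true].
Proof. by []. Qed.
Definition submoduleT := Submodule submoduleT_closed.

Fact submodule_meet_closed K L : submod_closed [pred v | v \in K & v \in L].
Proof.
split=> [|a u v /andP[uK uL] /andP[vK vL]]; rewrite inE ?rpred0 //.
by rewrite !rpredD ?rpredZ.
Qed.
Definition submodule_meet K L := Submodule (submodule_meet_closed K L).

Fact submodule_join_closed K L : submod_closed
  [pred v | `[< exists x y, [/\ x \in K, y \in L & v = x + y] >]].
Proof.
split=> [|a _ _ /asboolP[x [y [xK yL ->]]] /asboolP[x' [y' [xK' yL' ->]]]].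
  by apply/asboolP; exists 0, 0; rewrite !rpred0 addr0.
apply/asboolP; exists (a *: x + x'), (a *: y + y').
by rewrite !rpredD ?rpredZ // scalerDr addrACA.
Qed.
Definition submodule_join K L := Submodule (submodule_join_closed K L).

Fact submodule_lexI K L J :
  (K <= submodule_meet L J)%O = (K <= L)%O && (K <= J)%O.
Proof.
apply/submodule_leP/andP => [sK|[/submodule_leP sL /submodule_leP sJ] v vK].
  by split; apply/submodule_leP => v /sK /andP[].
by rewrite inE/=; apply/andP; split; [exact: sL | exact: sJ].
Qed.

Fact submodule_leUx K L J :
  (submodule_join K L <= J)%O = (K <= J)%O && (L <= J)%O.
Proof.
apply/submodule_leP/andP => [sKL|[/submodule_leP sK /submodule_leP sL] v].
  split; apply/submodule_leP => v vP; apply/sKL/asboolP.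
    by exists v, 0; rewrite rpred0 addr0.
  by exists 0, v; rewrite rpred0 add0r.
by case/asboolP => x [y [/sK xJ /sL yJ ->]]; rewrite rpredD.
Qed.

Fact submodule_le0x L : (submodule0 <= L)%O.
Proof. by apply/submodule_leP => v /eqP->; rewrite rpred0. Qed.

Fact submodule_lex1 L : (L <= submoduleT)%O.
Proof. exact/submodule_leP. Qed.

HB.instance Definition _ :=
  Order.POrder_isMeetSemilattice.Build submodule_display submodule
    submodule_lexI.
HB.instance Definition _ :=
  Order.POrder_isJoinSemilattice.Build submodule_display submodule
    submodule_leUx.
HB.instance Definition _ :=
  Order.hasBottom.Build submodule_display submodule submodule_le0x.
HB.instance Definition _ :=
  Order.hasTop.Build submodule_display submodule submodule_lex1.

Lemma in_submoduleI K L v : (v \in (K `&` L)%O) = (v \in K) && (v \in L).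
Proof. by []. Qed.

Lemma in_submoduleU K L v :
  (v \in (K `|` L)%O) <-> exists x y, [/\ x \in K, y \in L & v = x + y].
Proof. by split => /asboolP. Qed.

Lemma in_submodule0 v : (v \in (\bot%O : submodule)) = (v == 0).
Proof. by []. Qed.

Lemma in_submoduleT v : v \in (\top%O : submodule).
Proof. by []. Qed.

Fact submodule_sup_closed (X : set submodule) : submod_closed
  [pred v | `[< forall L, ubound X L -> v \in L >]].
Proof.
split=> [|a u v /asboolP uX /asboolP vX]; apply/asboolP => L XL.
  exact: rpred0.
by rewrite rpredD ?rpredZ ?uX ?vX.
Qed.
Definition submodule_sup X := Submodule (submodule_sup_closed X).

Fact submodule_supP X : isLub X (submodule_sup X).
Proof.
split=> [L XL|L XL]; apply/submodule_leP => v.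
  by move=> vL; apply/asboolP => K /(_ _ XL) /submodule_leP; apply.
by move/asboolP; apply.
Qed.

Fact submodule_modular K L J : (K <= J -> K `|` (L `&` J) = (K `|` L) `&` J)%O.
Proof.
move=> /submodule_leP sKJ; apply: eq_submodule => v; rewrite in_submoduleI.
apply/idP/andP => [/in_submoduleU[x [y [xK /andP[yL yJ] ->]]]|].
  split; first by apply/in_submoduleU; exists x, y.
  by rewrite rpredD // sKJ.
case=> /in_submoduleU[x [y [xK yL ->]]] xyJ; apply/in_submoduleU; exists x, y.
split=> //; rewrite in_submoduleI yL/= -(addKr x y).
by rewrite rpredD // submoduleN // sKJ.
Qed.

Fact submodule_directed_closed (X : set submodule) : directed X ->
  submod_closed [pred v | `[< exists2 L, X L & v \in L >]].
Proof.
move=> [[L0 XL0] dX]; split=> [|a u v /asboolP[K XK uK] /asboolP[L XL vL]].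
  by apply/asboolP; exists L0; rewrite ?rpred0.
have [J [XJ /submodule_leP sKJ /submodule_leP sLJ]] := dX _ _ XK XL.
by apply/asboolP; exists J; rewrite // rpredD ?rpredZ //;
  [exact: sKJ | exact: sLJ].
Qed.

Lemma in_directed_sup (X : set submodule) v : directed X ->
  v \in submodule_sup X -> exists2 L, X L & v \in L.
Proof.
move=> dX /asboolP/(_ (Submodule (submodule_directed_closed dX))) vX.
apply/asboolP/vX => L XL; apply/submodule_leP => w wL.
by apply/asboolP; exists L.
Qed.

Fact submodule_upper_continuous K (X : set submodule) : directed X ->
  (K `&` submodule_sup X)%O = submodule_sup [set (K `&` L)%O | L in X].
Proof.
move=> dX; apply: eq_submodule => v; rewrite in_submoduleI; apply/andP/idP.
  case=> vK /(in_directed_sup dX)[L XL vL]; apply/asboolP => J.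
  by move/(_ _ (imageP _ XL))/submodule_leP; apply; rewrite in_submoduleI vK.
move=> /asboolP vX; split.
  by apply: vX => _ [L XL <-]; exact: leIl.
apply: vX => _ [L XL <-]; apply: le_trans (leIr _ _) _.
by have [+ _] := submodule_supP X; apply.
Qed.

HB.instance Definition _ := TBLattice_isIdiom.Build submodule_display submodule
  submodule_supP submodule_modular submodule_upper_continuous.

End Submodules.

Section Nonsingular.
Context (R : pzRingType) (M : lmodType R).
Local Open Scope ring_scope.

Fact annihilator_closed (m : M) :
  submod_closed [pred r : R^o | (r : R) *: m == 0].
Proof.
split=> [|a r s]; rewrite !inE ?scale0r // => /eqP rm /eqP sm.
by rewrite scalerDl -scalerA rm sm scaler0 addr0.
Qed.

(* Left ideals of R are the submodules of R^o. *)
Definition annihilator (m : M) : submodule R^o :=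
  Submodule (annihilator_closed m).

Definition singular_part : set M :=
  [set m | essential \bot%O \top%O (annihilator m)].

Definition nonsingular_module := singular_part = [set 0].

End Nonsingular.

Section Preimage.
Context (R : pzRingType) (M N : lmodType R) (phi : {linear M -> N}).
Local Open Scope ring_scope.

Fact preimage_closed (L : submodule N) :
  submod_closed [pred m | phi m \in L].
Proof.
split=> [|a u v]; rewrite !inE ?linear0 ?rpred0 // linearP => uL vL.
by rewrite rpredD ?rpredZ.
Qed.

Definition submodule_preimage (L : submodule N) : submodule M :=
  Submodule (preimage_closed L).

End Preimage.

(* Main.v *)
From HB Require Import structures.
Require Import Defs.
From mathcomp Require Import all_boot all_order all_algebra.
From mathcomp Require Import boolp classical_sets.
From Stdlib Require Import Relations.Relation_Operators.

(** On a nonsingular module the Goldie nucleus is the singular closure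
    [g(L) = {m | (L : m) is an essential left ideal}], and [g] visibly commutes
    with preimages because [(phi^-1 L : m) = (L : phi m)].  To identify [zeta]
    with [g], one uses that [[a, b]] lies in [F_zeta] iff [zeta a /\ b = a], and
    that for nonsingular [M] the interval [[a, 1]] is nonsingular iff [g a = a].
    Applying both to [a := g x] gives [zeta x <= g x], and to [a := zeta x] gives
    [g x <= zeta x]. *)

Set Implicit Arguments.
Unset Strict Implicit.
Unset Printing Implicit Defensive.

Import Order.Theory GRing.Theory.
Local Open Scope classical_set_scope.
Local Open Scope order_scope.

(** * Prenuclei, the nucleus [chi] and similar intervals in an idiom *)

Section Idioms.
Context d (A : idiomType d).
Implicit Types (a b c x y z : A) (I J : A * A) (j k p q : A -> A).

Lemma isup_ub (X : set A) x : X x -> x <= isup X.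
Proof. by move=> Xx; have [+ _] := isupP X; apply. Qed.

Lemma isup_le (X : set A) y : (forall x, X x -> x <= y) -> isup X <= y.
Proof. by move=> Xy; have [_] := isupP X; apply. Qed.

(** Upper continuity applies in each argument in turn; this yields the meet law for [chi]. *)
Lemma isup_meet_le (X Y : set A) z : directed X -> directed Y ->
  (forall x y, X x -> Y y -> x `&` y <= z) -> isup X `&` isup Y <= z.
Proof.
move=> dX dY XYz; rewrite idiom_upper_continuous //.
apply: isup_le => _ [y Yy <-]; rewrite meetC idiom_upper_continuous //.
by apply: isup_le => _ [x Xx <-]; rewrite meetC; exact: XYz.
Qed.

(** A nucleus without idempotence; [singular_closure] will be one over every module. *)
Definition prenucleus p :=
  [/\ {homo p : x y / x <= y}, forall x, x <= p x
    & forall x y, p x `&` p y <= p (x `&` y)].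

Lemma nucleus_prenucleus j : nucleus j -> prenucleus j.
Proof. by case. Qed.

Lemma prenucleus_id : prenucleus id.
Proof. by split. Qed.

Lemma prenucleus_comp p q : prenucleus p -> prenucleus q ->
  prenucleus (p \o q).
Proof.
move=> [hp ip mp] [hq iq mq]; split=> [x y xy|x|x y] /=; first exact/hp/hq.
  exact: le_trans (iq x) (ip _).
exact: le_trans (mp _ _) (hp _ _ (mq _ _)).
Qed.

Section Chi.
Context (a b : A) (le_ab : a <= b).

(* Unlike nuclei, prenuclei are closed under composition, so this family is
   directed and its pointwise supremum is again in it. *)
Let chi_family : set (A -> A) :=
  [set p | prenucleus p /\ p a `&` b = a].

Let chi x := isup [set p x | p in chi_family].

(** Since [b <= p b], one has [p (q a) /\ b <= p (q a) /\ p b <= p (q a /\ b) = p a], and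
    [p a /\ b = a]. *)
Let chi_family_comp p q :
  chi_family p -> chi_family q -> chi_family (p \o q).
Proof.
move=> [Pp pa] [Pq qa]; split; first exact: prenucleus_comp.
have [hp ip mp] := Pp; have [_ iq _] := Pq.
apply/le_anti/andP; split=> /=; last first.
  by rewrite lexI le_ab andbT (le_trans (iq a)).
rewrite -[leRHS]pa lexI leIr andbT -[in leRHS]qa.
by apply: le_trans (mp _ _); rewrite leI2.
Qed.

Let le_chi p x : chi_family p -> p x <= chi x.
Proof. by move=> Fp; apply: isup_ub; exists p. Qed.

Let chi_directed x : directed [set p x | p in chi_family].
Proof.
split; first by exists x, id; split; [exact: prenucleus_id | exact/meet_idPl].
move=> _ _ [p Fp <-] [q Fq <-]; exists (p (q x)).
have [[[hp ip _] _] [[_ iq _] _]] := (Fp, Fq); split=> //; last exact: hp.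
by exists (p \o q) => //; exact: chi_family_comp.
Qed.

Let chi_in_family : chi_family chi.
Proof.
have Fid : chi_family id.
  by split; [exact: prenucleus_id | exact/meet_idPl].
split; first split=> [x y xy|x|x y].
- apply: isup_le => _ [p Fp <-]; have [[hp _ _] _] := Fp.
  exact: le_trans (hp _ _ xy) (le_chi _ Fp).
- exact: (le_chi x Fid).
- apply: isup_meet_le => // _ _ [p Fp <-] [q Fq <-].
  (* The single member [p \o q] bounds both factors: [p x /\ q y <= p (q x) /\ p (q y) <= p (q (x /\
     y))]. *)
  apply: le_trans (le_chi _ (chi_family_comp Fp Fq)).
  have [[[hp ip mp] _] [[_ iq mq] _]] := (Fp, Fq).
  apply: le_trans (hp _ _ (mq x y)); apply: le_trans (mp _ _).
  by apply: leI2 => //; exact: hp.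
- apply/le_anti/andP; split; last by rewrite lexI le_ab andbT (le_chi _ Fid).
  rewrite meetC idiom_upper_continuous //.
  by apply: isup_le => _ [_ [p [_ pa] <-] <-]; rewrite meetC pa.
Qed.

Lemma ex_chi : exists k, is_chi a b k.
Proof.
have [[hk ik mk] ka] := chi_in_family.
exists chi; split=> // [|j nj ja x]; last first.
  by apply: le_chi; split=> //; exact: nucleus_prenucleus.
split=> // x; apply/le_anti; rewrite ik andbT.
(* Idempotence: [chi \o chi] is in the family, hence below its supremum [chi]. *)
exact: (le_chi x (chi_family_comp chi_in_family chi_in_family)).
Qed.

(** Existence and maximality of [chi(a, b)] turn membership in [F_j] into an equation for [j]
    alone. *)
Lemma free_intervalsP j : nucleus j ->
  free_intervals j (a, b) <-> j a `&` b = a.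
Proof.
move=> nj; split=> [[_ [k [_ ka _] jk]]|ja].
  apply/le_anti/andP; split; last by rewrite lexI le_ab andbT; case: nj.
  by rewrite -[leRHS]ka leI2 //; exact: jk.
have [k kP] := ex_chi; split=> //; exists k => //.
by have [_ _] := kP; exact.
Qed.

End Chi.

Lemma goldie_nucleus_fix j a : goldie_nucleus j ->
  j a = a <-> nonsingular_interval a \top.
Proof.
move=> [nj Fj]; have := free_intervalsP (lex1 a) nj.
by rewrite Fj meetx1; exact: iff_sym.
Qed.

(** From [l \/ r <= p l] follows [r <= p l /\ p r <= p (l /\ r)]; conversely [r <= p (l /\ r)] gives
    [r <= p l]. *)
Lemma similar_prenucleus p I J : prenucleus p -> Defs.similar I J ->
  I.2 <= p I.1 -> J.2 <= p J.1.
Proof.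
move=> [hp ip mp] [l [r [] [-> ->]]] /=.
  rewrite leUx => /andP[_ rl]; apply: le_trans (mp l r).
  by rewrite lexI rl ip.
by move=> rp; rewrite leUx ip (le_trans rp) // hp // leIl.
Qed.

Lemma similar_trans_prenucleus p I J : prenucleus p -> similar_trans I J ->
  I.2 <= p I.1 -> J.2 <= p J.1.
Proof.
move=> Pp; elim=> {I J} [I J|I K J _ IK _ KJ]; last by move/IK/KJ.
exact: similar_prenucleus.
Qed.

(** Either of the two intervals collapses exactly when [r <= l]. *)
Lemma similar_degenerate I J : Defs.similar I J -> J.1 = J.2 -> I.1 = I.2.
Proof.
move=> [l [r [] [-> ->]]] /= /esym.
  by move/esym/meet_idPr => rl; apply/esym/join_idPl.
by move=> lr; apply/meet_idPr; rewrite -[leRHS]lr leUr.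
Qed.

Lemma similar_trans_degenerate I J :
  similar_trans I J -> J.1 = J.2 -> I.1 = I.2.
Proof.
elim=> {I J} [I J|I K J _ IK _ KJ]; first exact: similar_degenerate.
by move/KJ/IK.
Qed.

Lemma essential_le x y : x <= y ->
  essential \bot \top x -> essential \bot \top y.
Proof.
move=> xy [_ ex]; split=> [|z _ yz]; first by rewrite le0x lex1.
apply: ex; first by rewrite le0x lex1.
by apply/eqP; rewrite -lex0 -yz leI2.
Qed.

Lemma essential_meet x y : essential \bot \top x -> essential \bot \top y ->
  essential \bot \top (x `&` y).
Proof.
move=> [_ ex] [_ ey]; split=> [|z zP]; first by rewrite le0x lex1.
by rewrite -meetA => /ex yz; apply/ey/yz; rewrite // le0x lex1.
Qed.

End Idioms.

(** * Elementwise criteria for essential submodules *)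

Section Cyclic.
Context (R : pzRingType) (V : lmodType R).
Local Open Scope ring_scope.

Fact cyclic_closed (v : V) :
  submod_closed [pred w | `[< exists r : R, w = r *: v >]].
Proof.
split=> [|a _ _ /asboolP[r ->] /asboolP[s ->]]; apply/asboolP.
  by exists 0; rewrite scale0r.
by exists (a * r + s); rewrite scalerDl scalerA.
Qed.
Definition cyclic_submodule (v : V) := Submodule (cyclic_closed v).

Lemma in_cyclic (v w : V) :
  w \in cyclic_submodule v <-> exists r : R, w = r *: v.
Proof. by split=> /asboolP. Qed.

Lemma cyclic_le (v : V) (L : submodule V) :
  (cyclic_submodule v <= L)%O = (v \in L).
Proof.
apply/submodule_leP/idP => [|vL _ /in_cyclic[r ->]]; last exact: rpredZ.
by apply; apply/in_cyclic; exists 1; rewrite scale1r.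
Qed.

(** Testing against cyclic submodules suffices, since every nonzero submodule contains a nonzero
    cyclic one. *)
Lemma essentialP (K L : submodule V) : (K <= L)%O ->
  essential \bot%O L K <->
  forall v, v \in L -> v != 0 -> exists2 r : R, r *: v \in K & r *: v != 0.
Proof.
move=> KL; split=> [[_ eK] v vL v0|eK].
  apply: contra_notP (negP v0) => Kv0.
  rewrite -in_submodule0 -(eK (cyclic_submodule v)).
  - by rewrite -cyclic_le.
  - by rewrite le0x cyclic_le.
  apply/eqP; rewrite -lex0; apply/submodule_leP => w.
  rewrite in_submoduleI => /andP[wK /in_cyclic[r wr]].
  by apply: contra_notT Kv0 => w0; exists r; rewrite -wr.
split=> [|J /andP[_ /submodule_leP JL] KJ]; first by rewrite le0x.
apply/eqP; rewrite -lex0; apply/submodule_leP => v vJ.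
apply/negPn/negP => v0; have [r rK /negP[]] := eK v (JL _ vJ) v0.
by rewrite -in_submodule0 -KJ in_submoduleI rK rpredZ.
Qed.

Lemma essentialTP (K : submodule V) : essential \bot%O \top%O K <->
  forall v, v != 0 -> exists2 r : R, r *: v \in K & r *: v != 0.
Proof.
split=> [/(essentialP (lex1 _)) eK v|eK]; first exact: eK.
by apply/(essentialP (lex1 _)) => v _; exact: eK.
Qed.

End Cyclic.

Lemma essential_preimage (R : pzRingType) (V W : lmodType R)
    (f : {linear V -> W}) (L : submodule W) :
  essential \bot%O \top%O L ->
  essential \bot%O \top%O (submodule_preimage f L).
Proof.
move=> /essentialTP eL; apply/essentialTP => v v0.
have [fv0|/eL[r rL rf0]] := eqVneq (f v) 0%R.
  by exists 1%R; rewrite scale1r // inE fv0 rpred0.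
exists r; first by rewrite inE linearZ.
by apply: contraNneq rf0 => rv0; rewrite -linearZ /= rv0 linear0.
Qed.

(** * The left ideals [(L : v)] *)

Section Colon.
Context (R : pzRingType) (V : lmodType R).
Local Open Scope ring_scope.
Implicit Types (K L : submodule V) (v : V).

(** Packaged as a linear map so that [(L : v)] is a preimage and [essential_preimage] applies to
    it. *)
Definition scale_at v (r : R^o) : V := (r : R) *: v.

Fact scale_at_linear v : linear (scale_at v).
Proof. by move=> a r s; rewrite /scale_at scalerDl scalerA. Qed.

HB.instance Definition _ v :=
  GRing.isLinear.Build R R^o V *:%R (scale_at v) (scale_at_linear v).

(* The left ideal (L : v). *)
Definition colon L v : submodule R^o :=
  submodule_preimage (scale_at v) L.

Lemma in_colon L v (r : R^o) : (r \in colon L v) = ((r : R) *: v \in L).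
Proof. by split. Qed.

Lemma annihilatorE v : annihilator v = colon \bot%O v.
Proof. exact: eq_submodule. Qed.

Lemma colon_le K L v : (K <= L)%O -> (colon K v <= colon L v)%O.
Proof. by move=> /submodule_leP KL; apply/submodule_leP => r /KL. Qed.

Lemma colon_meet K L v : colon (K `&` L)%O v = (colon K v `&` colon L v)%O.
Proof. exact: eq_submodule. Qed.

End Colon.

(** * The singular closure of a submodule *)

Section SingularClosure.
Context (R : pzRingType) (V : lmodType R).
Local Open Scope ring_scope.
Implicit Types (K L : submodule V) (u v : V).

(** [(L : a v)] is the preimage of [(L : v)] under right multiplication by [a]. *)
Lemma essential_colonZ L (a : R) v : essential \bot%O \top%O (colon L v) ->
  essential \bot%O \top%O (colon L (a *: v)).
Proof.
move=> /(essential_preimage (@scale_at _ R^o (a : R^o))).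
apply: essential_le; apply/submodule_leP => r.
by rewrite inE !in_colon scalerA.
Qed.

Fact singular_closure_closed L :
  submod_closed [pred v | `[< essential \bot%O \top%O (colon L v) >]].
Proof.
split=> [|a u v /asboolP uL /asboolP vL]; apply/asboolP.
  apply/essentialTP => s s0; exists 1; rewrite ?scale1r //.
  by rewrite in_colon scaler0 rpred0.
apply: essential_le (essential_meet (essential_colonZ a uL) vL).
apply/submodule_leP => r; rewrite in_submoduleI !in_colon => /andP[ru rv].
by rewrite scalerDr rpredD.
Qed.
(** The preimage in [V] of the singular submodule of [V / L]. *)
Definition singular_closure L := Submodule (singular_closure_closed L).

Lemma in_singular_closure L v :
  v \in singular_closure L <-> essential \bot%O \top%O (colon L v).
Proof. by split=> /asboolP. Qed.

Lemma singular_closure_prenucleus : prenucleus singular_closure.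
Proof.
split=> [K L KL|L|K L]; apply/submodule_leP => v.
- move/in_singular_closure => eK; apply/in_singular_closure.
  exact: essential_le (colon_le v KL) eK.
- move=> vL; apply/in_singular_closure/essentialTP => s s0; exists 1.
    by rewrite in_colon rpredZ.
  by rewrite scale1r.
- rewrite in_submoduleI => /andP[/in_singular_closure eK].
  move/in_singular_closure => eL; apply/in_singular_closure.
  by rewrite colon_meet; exact: essential_meet.
Qed.

(** For [v] in [L] and [s != 0], either [s v = 0] and [s] is already in [(K : v)], or some [r s v]
    is nonzero in [K], which forces [r s != 0]. *)
Lemma essential_le_singular_closure K L :
  essential \bot%O L K -> (L <= singular_closure K)%O.
Proof.
move=> eK; have [/andP[_ KL] _] := eK; move/(essentialP KL): eK => eK.
apply/submodule_leP => v vL; apply/in_singular_closure/essentialTP => s s0.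
have [sv0|/eK[|r rK rsv0]] := eqVneq ((s : R) *: v) 0.
- by exists 1; rewrite scale1r // in_colon sv0 rpred0.
- exact: rpredZ.
exists r; first by rewrite in_colon -scalerA.
by apply: contraNneq rsv0 => rs0; rewrite scalerA [r * s]rs0 scale0r.
Qed.

(** The bound [e <= singular_closure c] passes along similarity to [x <= singular_closure L = L]; so
    [[L, x]] collapses, and with it [[c, e]]. *)
Lemma singular_closure_fix_nonsingular L :
  singular_closure L = L -> nonsingular_interval L \top%O.
Proof.
move=> gL; split=> [|x c e /andP[Lx _] sim ec]; first exact: lex1.
apply: (similar_trans_degenerate sim) => /=; apply/le_anti; rewrite Lx /=.
rewrite -[leRHS]gL.
apply: (similar_trans_prenucleus singular_closure_prenucleus sim).
exact: essential_le_singular_closure.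
Qed.

(** * Comparison with the Goldie nucleus over a nonsingular module *)

Context (nsV : nonsingular_module V).

Lemma nonsingular_eq0 v : essential \bot%O \top%O (annihilator v) -> v = 0.
Proof. by move=> ev; have : singular_part v by []; rewrite nsV. Qed.

(* If [r v] is in [singular_closure L] and [(L : r v) r = 0], then [r] is
   singular in [R], so [r v] is killed by an essential left ideal and vanishes. *)
Lemma singular_closure_idem L :
  singular_closure (singular_closure L) = singular_closure L.
Proof.
have [_ ig _] := singular_closure_prenucleus.
apply/le_anti; rewrite ig andbT; apply/submodule_leP => v.
move/in_singular_closure/essentialTP => eg.
apply/in_singular_closure/essentialTP => s /eg[r].
set s' := r *: s; rewrite in_colon => /in_singular_closure es' s'0.
have [[t tL ts'0]|nt] := pselect (exists2 t : R,
    t *: ((s' : R) *: v) \in L & t *: s' != 0).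
  exists (t * r); last by rewrite -scalerA.
  by rewrite -scalerA in_colon -scalerA.
exists r => //; rewrite in_colon (@nonsingular_eq0 ((s' : R) *: v)) ?rpred0 //.
apply: essential_le es'; apply/submodule_leP => t; rewrite in_colon => tL.
have ts'0 : t *: s' = 0 by apply: contra_notP nt => /eqP; exists t.
by rewrite annihilatorE in_colon scalerA [t * s']ts'0 scale0r rpred0.
Qed.

(** For [v] in the closure and [C = R v], the meet [L /\ C] is essential in [C]. As [[L /\ C, C]] is
    similar to [[L, L \/ C]], nonsingularity forces [C <= L]. *)
Lemma nonsingular_singular_closure_fix L :
  nonsingular_interval L \top%O -> singular_closure L = L.
Proof.
move=> [_ nsL]; have [_ ig _] := singular_closure_prenucleus.
apply/le_anti; rewrite ig andbT; apply/submodule_leP => v.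
move=> /in_singular_closure ev; set C := cyclic_submodule v.
suff LC : (L `&` C)%O = C by rewrite -cyclic_le -/C -LC leIl.
apply: (nsL (L `|` C)%O); first by rewrite leUl lex1.
  by apply: t_step; exists L, C; right.
split=> [|J /andP[_ JC] LJ]; first by rewrite le0x leIr.
apply/eqP; rewrite -lex0; apply/submodule_leP => w wJ.
move/submodule_leP: JC => /(_ w wJ) wC; have /in_cyclic[r wr] := wC.
(* [(L : w)] is essential because [w] is a multiple of [v], and it kills [w] because [t w] then lies
   in [L /\ J = 0]. *)
rewrite in_submodule0; apply/eqP/nonsingular_eq0.
have ew : essential \bot%O \top%O (colon L w).
  by rewrite wr; exact: essential_colonZ.
apply: essential_le ew; apply/submodule_leP => t; rewrite in_colon => tL.
by rewrite annihilatorE in_colon -LJ !in_submoduleI tL !rpredZ.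
Qed.

Lemma goldie_nucleusE zeta : goldie_nucleus zeta -> zeta =1 singular_closure.
Proof.
move=> Gz L; have [[hz iz _ zz] _] := Gz.
have [hg ig _] := singular_closure_prenucleus.
apply/le_anti/andP; split.
  rewrite (le_trans (hz _ _ (ig L))) //.
  have /(goldie_nucleus_fix _ Gz) -> // :
    nonsingular_interval (singular_closure L) \top%O.
  exact/singular_closure_fix_nonsingular/singular_closure_idem.
rewrite (le_trans (hg _ _ (iz L))) //.
by rewrite nonsingular_singular_closure_fix //; apply/(goldie_nucleus_fix _ Gz).
Qed.

End SingularClosure.

Theorem proposition5p30 (R : pzRingType) (M N : lmodType R)
  (phi : {linear M -> N})
  (zetaM : submodule M -> submodule M) (zetaN : submodule N -> submodule N) :
  nonsingular_module M -> nonsingular_module N ->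
  goldie_nucleus zetaM -> goldie_nucleus zetaN ->
  forall L : submodule N,
    submodule_preimage phi (zetaN L) = zetaM (submodule_preimage phi L).
Proof.
move=> nsM nsN GM GN L.
rewrite (goldie_nucleusE nsM GM) (goldie_nucleusE nsN GN).
apply: eq_submodule => m.
have colonE : colon L (phi m) = colon (submodule_preimage phi L) m.
  by apply: eq_submodule => r; rewrite !in_colon inE linearZ.
by apply/idP/idP => /in_singular_closure em; apply/in_singular_closure;
  rewrite ?colonE // -colonE.
Qed.
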